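(* (a) The integral axioms are independent from the rest of the axioms of a braided ribbon Hopf algebra: there exist a braided monoidal category $\mathcal C$ and a Hopf algebra $H$ in $\mathcal C$ with an invertible morphism $v:H\to H$ and a copairing $\sigma:\mathbf 1\to H\diamond H$ satisfying all of the Hopf algebra axioms (a1)–(a8), (s1)–(s2') and all of the ribbon axioms (r3)–(r9), such that there are no morphisms $L:\mathbf 1\to H$, $l:H\to\mathbf 1$ satisfying (i1)–(i4). (b) The ribbon axioms (r8) and (r9) are independent from the rest of the axioms of a braided ribbon Hopf algebra: neither (r8) nor (r9) is a consequence of the remaining axioms, i.e. for each of (r8) and (r9) there exist a braided monoidal category $\mathcal C$ and a unimodular Hopf algebra $H$ in $\mathcal C$ with an invertible morphism $v:H\to H$ and a copairing $\sigma:\mathbf 1\to H\diamond H$ which satisfy (r3)–(r7) but for which that axiom fails.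
   Context: Let $(\mathcal C,\diamond,\mathbf 1,\gamma)$ be a braided monoidal category with product $\diamond$, unit object $\mathbf 1$ and braiding $\gamma$ (associativity and unit constraints are suppressed); for an object $H$ write $\gamma=\gamma_{H,H}$, $\bar\gamma=\gamma^{-1}$, $\mathrm{id}=\mathrm{id}_H$. A (braided) Hopf algebra in $\mathcal C$ is an object $H$ with morphisms $\Delta:H\to H\diamond H$, $\epsilon:H\to\mathbf 1$, $m:H\diamond H\to H$, $\eta:\mathbf 1\to H$, $S,\bar S:H\to H$ such that (a1) $(\Delta\diamond\mathrm{id})\circ\Delta=(\mathrm{id}\diamond\Delta)\circ\Delta$; (a2-2') $(\epsilon\diamond\mathrm{id})\circ\Delta=\mathrm{id}=(\mathrm{id}\diamond\epsilon)\circ\Delta$; (a3) $m\circ(m\diamond\mathrm{id})=m\circ(\mathrm{id}\diamond m)$; (a4-4') $m\circ(\mathrm{id}\diamond\eta)=\mathrm{id}=m\circ(\eta\diamond\mathrm{id})$; (a5) $(m\diamond m)\circ(\mathrm{id}\diamond\gamma\diamond\mathrm{id})\circ(\Delta\diamond\Delta)=\Delta\circ m$; (a6) $\epsilon\circ m=\epsilon\diamond\epsilon$; (a7) $\Delta\circ\eta=\eta\diamond\eta$; (a8) $\epsilon\circ\eta=\mathrm{id}_{\mathbf 1}$; (s1) $m\circ(S\diamond\mathrm{id})\circ\Delta=\eta\circ\epsilon$; (s1') $m\circ(\mathrm{id}\diamond S)\circ\Delta=\eta\circ\epsilon$; (s2-2') $S\circ\bar S=\bar S\circ S=\mathrm{id}$.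 A unimodular Hopf algebra is a Hopf algebra with an integral $L:\mathbf 1\to H$ and a cointegral $l:H\to\mathbf 1$ such that (i1) $(\mathrm{id}\diamond l)\circ\Delta=\eta\circ l$; (i2) $m\circ(L\diamond\mathrm{id})=L\circ\epsilon$; (i3) $l\circ L=\mathrm{id}_{\mathbf 1}$; (i4) $S\circ L=L$; (i5) $l\circ S=l$. A (braided) ribbon Hopf algebra is a unimodular Hopf algebra with an invertible ribbon morphism $v:H\to H$ and a copairing $\sigma:\mathbf 1\to H\diamond H$ such that (r3) $S\circ v=v\circ S$; (r4) $\epsilon\circ v=\epsilon$; (r5) $m\circ(v\diamond\mathrm{id})=v\circ m$; (r6) $\sigma=(v^{-1}\diamond(v^{-1}\circ S))\circ\Delta\circ v\circ\eta$; (r7) $(\Delta\diamond\mathrm{id})\circ\sigma=(\mathrm{id}\diamond\mathrm{id}\diamond m)\circ(\mathrm{id}\diamond\sigma\diamond\mathrm{id})\circ\sigma$; (r8) $\Delta\circ v^{-1}=(v^{-1}\diamond v^{-1})\circ\mu\circ\bar\gamma\circ\Delta$; (r9) $(m\diamond m)\circ(S\diamond(\mu\circ\bar\gamma\circ\mu)\diamond S)\circ(\rho_l\diamond\rho_r)=\gamma$, where $\mu=(m\diamond m)\circ(\mathrm{id}\diamond\sigma\diamond\mathrm{id}):H\diamond H\to H\diamond H$, $\rho_l=(\mathrm{id}\diamond m)\circ(\sigma\diamond\mathrm{id}):H\to H\diamond H$, $\rho_r=(m\diamond\mathrm{id})\circ(\mathrm{id}\diamond\sigma):H\to H\diamond H$.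 The universal braided ribbon Hopf algebra $\mathcal H^r$ is the strict braided monoidal category freely generated by a ribbon Hopf algebra $H$; its ''axioms'' are the axioms listed above. *)

(* Defs.v *)
Set Implicit Arguments.
Unset Strict Implicit.
Unset Printing Implicit Defensive.

Declare Scope cat_ob_scope.
Declare Scope cat_hom_scope.
Delimit Scope cat_ob_scope with ob.
Delimit Scope cat_hom_scope with hom.

Reserved Notation "A ~> B" (at level 70, no associativity).
Reserved Notation "g ∘ f" (at level 40, left associativity).
Reserved Notation "x ⋄ y" (at level 35, no associativity).

Record category := Category {
  ob : Type;
  hom : ob -> ob -> Type;
  idm : forall A, hom A A;
  comp : forall A B C, hom B C -> hom A B -> hom A C;
  comp_idl : forall A B (f : hom A B), comp (idm B) f = f;
  comp_idr : forall A B (f : hom A B), comp f (idm A) = f;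
  comp_assoc : forall A B C D (h : hom C D) (g : hom B C) (f : hom A B),
    comp h (comp g f) = comp (comp h g) f
}.

Bind Scope cat_ob_scope with ob.
Bind Scope cat_hom_scope with hom.
Arguments hom {c} (A B)%_cat_ob_scope.
Arguments idm {c} A%_cat_ob_scope.
Arguments comp {c A B C} (g f)%_cat_hom_scope.

Notation "A ~> B" := (hom A%ob B%ob) : type_scope.
Notation "g ∘ f" := (comp g f) : cat_hom_scope.
Open Scope cat_hom_scope.

Record monoidal := Monoidal {
  mon_cat :> category;
  tens : ob mon_cat -> ob mon_cat -> ob mon_cat;
  tensm : forall A B A' B' : ob mon_cat,
    A ~> A' -> B ~> B' -> tens A B ~> tens A' B';
  unit_ob : ob mon_cat;
  assoc : forall A B C, tens (tens A B) C ~> tens A (tens B C);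
  assoc_inv : forall A B C, tens A (tens B C) ~> tens (tens A B) C;
  lunit : forall A, tens unit_ob A ~> A;
  lunit_inv : forall A, A ~> tens unit_ob A;
  runit : forall A, tens A unit_ob ~> A;
  runit_inv : forall A, A ~> tens A unit_ob;
  tensm_id : forall A B, tensm (idm A) (idm B) = idm (tens A B);
  tensm_comp : forall A B A' B' A'' B'' (f' : A' ~> A'') (g' : B' ~> B'')
      (f : A ~> A') (g : B ~> B'),
    tensm (f' ∘ f) (g' ∘ g) = tensm f' g' ∘ tensm f g;
  assoc_nat : forall A B C A' B' C' (f : A ~> A') (g : B ~> B') (h : C ~> C'),
    assoc A' B' C' ∘ tensm (tensm f g) h = tensm f (tensm g h) ∘ assoc A B C;
  lunit_nat : forall A A' (f : A ~> A'),
    lunit A' ∘ tensm (idm unit_ob) f = f ∘ lunit A;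
  runit_nat : forall A A' (f : A ~> A'),
    runit A' ∘ tensm f (idm unit_ob) = f ∘ runit A;
  assocK : forall A B C, assoc_inv A B C ∘ assoc A B C = idm _;
  assocVK : forall A B C, assoc A B C ∘ assoc_inv A B C = idm _;
  lunitK : forall A, lunit_inv A ∘ lunit A = idm _;
  lunitVK : forall A, lunit A ∘ lunit_inv A = idm _;
  runitK : forall A, runit_inv A ∘ runit A = idm _;
  runitVK : forall A, runit A ∘ runit_inv A = idm _;
  pentagon : forall A B C D,
    assoc A B (tens C D) ∘ assoc (tens A B) C D =
    tensm (idm A) (assoc B C D) ∘ assoc A (tens B C) D
      ∘ tensm (assoc A B C) (idm D);
  triangle : forall A B,
    tensm (idm A) (lunit B) ∘ assoc A unit_ob B = tensm (runit A) (idm B)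
}.

Arguments tens {m} (A B)%_cat_ob_scope.
Arguments tensm {m A B A' B'} (f g)%_cat_hom_scope.
Arguments unit_ob {m}.
Arguments assoc {m} (A B C)%_cat_ob_scope.
Arguments assoc_inv {m} (A B C)%_cat_ob_scope.
Arguments lunit {m} A%_cat_ob_scope.
Arguments lunit_inv {m} A%_cat_ob_scope.
Arguments runit {m} A%_cat_ob_scope.
Arguments runit_inv {m} A%_cat_ob_scope.

Notation "A ⋄ B" := (tens A B) : cat_ob_scope.
Notation "f ⋄ g" := (tensm f g) : cat_hom_scope.

Record braided := Braided {
  br_mon :> monoidal;
  braid : forall A B : ob br_mon, A ⋄ B ~> B ⋄ A;
  braid_inv : forall A B : ob br_mon, B ⋄ A ~> A ⋄ B;
  braid_nat : forall (A B A' B' : ob br_mon) (f : A ~> A') (g : B ~> B'),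
    braid A' B' ∘ (f ⋄ g) = (g ⋄ f) ∘ braid A B;
  braidK : forall A B, braid_inv A B ∘ braid A B = idm _;
  braidVK : forall A B, braid A B ∘ braid_inv A B = idm _;
  hexagon1 : forall A B C,
    assoc B C A ∘ braid A (B ⋄ C) ∘ assoc A B C =
    (idm B ⋄ braid A C) ∘ assoc B A C ∘ (braid A B ⋄ idm C);
  hexagon2 : forall A B C,
    assoc_inv C A B ∘ braid (A ⋄ B) C ∘ assoc_inv A B C =
    (braid A C ⋄ idm B) ∘ assoc_inv A C B ∘ (idm A ⋄ braid B C)
}.

Arguments braid {b} (A B)%_cat_ob_scope.
Arguments braid_inv {b} (A B)%_cat_ob_scope.

(* By coherence, the bracketing chosen below is immaterial: fourfold products
   are always bracketed as (A ⋄ B) ⋄ (C ⋄ D). *)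

(* f ⋄ g ⋄ h, where g acts on the two middle factors *)
Definition mid3 (C : monoidal) (A1 A2 A3 A4 B1 B2 B3 B4 : ob C)
    (f : A1 ~> B1) (g : A2 ⋄ A3 ~> B2 ⋄ B3) (h : A4 ~> B4) :
    (A1 ⋄ A2) ⋄ (A3 ⋄ A4) ~> (B1 ⋄ B2) ⋄ (B3 ⋄ B4) :=
  assoc_inv B1 B2 (B3 ⋄ B4) ∘ (idm B1 ⋄ assoc B2 B3 B4)
    ∘ (f ⋄ (g ⋄ h))
    ∘ (idm A1 ⋄ assoc_inv A2 A3 A4) ∘ assoc A1 A2 (A3 ⋄ A4).

(* id ⋄ s ⋄ id, for a copairing s inserted between two factors *)
Definition insert_mid (C : monoidal) (A D X Y : ob C) (s : unit_ob ~> X ⋄ Y) :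
    A ⋄ D ~> (A ⋄ X) ⋄ (Y ⋄ D) :=
  assoc (A ⋄ X) Y D ∘ (assoc_inv A X Y ⋄ idm D)
    ∘ ((idm A ⋄ s) ⋄ idm D) ∘ (runit_inv A ⋄ idm D).

Record hopf_algebra (C : braided) := HopfAlgebra {
  carrier :> ob C;
  Delta : carrier ~> carrier ⋄ carrier;
  epsilon : carrier ~> unit_ob;
  mul : carrier ⋄ carrier ~> carrier;
  eta : unit_ob ~> carrier;
  antipode : carrier ~> carrier;
  antipode_inv : carrier ~> carrier;
  axiom_a1 :
    assoc carrier carrier carrier ∘ (Delta ⋄ idm carrier) ∘ Delta =
    (idm carrier ⋄ Delta) ∘ Delta;
  axiom_a2 : lunit carrier ∘ (epsilon ⋄ idm carrier) ∘ Delta = idm carrier;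
  axiom_a2' : runit carrier ∘ (idm carrier ⋄ epsilon) ∘ Delta = idm carrier;
  axiom_a3 :
    mul ∘ (mul ⋄ idm carrier) =
    mul ∘ (idm carrier ⋄ mul) ∘ assoc carrier carrier carrier;
  axiom_a4 : mul ∘ (idm carrier ⋄ eta) ∘ runit_inv carrier = idm carrier;
  axiom_a4' : mul ∘ (eta ⋄ idm carrier) ∘ lunit_inv carrier = idm carrier;
  axiom_a5 :
    (mul ⋄ mul)
      ∘ mid3 (idm carrier) (braid carrier carrier) (idm carrier)
      ∘ (Delta ⋄ Delta) =
    Delta ∘ mul;
  axiom_a6 : epsilon ∘ mul = lunit unit_ob ∘ (epsilon ⋄ epsilon);
  axiom_a7 : Delta ∘ eta = (eta ⋄ eta) ∘ lunit_inv unit_ob;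
  axiom_a8 : epsilon ∘ eta = idm unit_ob;
  axiom_s1 : mul ∘ (antipode ⋄ idm carrier) ∘ Delta = eta ∘ epsilon;
  axiom_s1' : mul ∘ (idm carrier ⋄ antipode) ∘ Delta = eta ∘ epsilon;
  axiom_s2 : antipode ∘ antipode_inv = idm carrier;
  axiom_s2' : antipode_inv ∘ antipode = idm carrier
}.

Arguments Delta {C} _.
Arguments epsilon {C} _.
Arguments mul {C} _.
Arguments eta {C} _.
Arguments antipode {C} _.
Arguments antipode_inv {C} _.

Section IntegralAxioms.
Variables (C : braided) (H : hopf_algebra C).
Variables (L : unit_ob ~> H) (l : H ~> unit_ob).

Definition axiom_i1 := runit H ∘ (idm H ⋄ l) ∘ Delta H = eta H ∘ l.
Definition axiom_i2 := mul H ∘ (L ⋄ idm H) ∘ lunit_inv H = L ∘ epsilon H.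
Definition axiom_i3 := l ∘ L = idm unit_ob.
Definition axiom_i4 := antipode H ∘ L = L.
Definition axiom_i5 := l ∘ antipode H = l.

End IntegralAxioms.

Record unimodular_hopf_algebra (C : braided) := UnimodularHopfAlgebra {
  uni_hopf :> hopf_algebra C;
  integral : unit_ob ~> uni_hopf;
  cointegral : uni_hopf ~> unit_ob;
  uni_i1 : axiom_i1 cointegral;
  uni_i2 : axiom_i2 integral;
  uni_i3 : axiom_i3 integral cointegral;
  uni_i4 : axiom_i4 integral;
  uni_i5 : axiom_i5 cointegral
}.

Definition mutually_inverse (C : category) (A B : ob C)
    (f : A ~> B) (g : B ~> A) : Prop :=
  g ∘ f = idm A /\ f ∘ g = idm B.

Section RibbonAxioms.
Variables (C : braided) (H : hopf_algebra C).
Variables (v vinv : H ~> H) (sigma : unit_ob ~> H ⋄ H).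

Definition mu : H ⋄ H ~> H ⋄ H := (mul H ⋄ mul H) ∘ insert_mid H H sigma.

Definition rho_l : H ~> H ⋄ H :=
  (idm H ⋄ mul H) ∘ assoc H H H ∘ (sigma ⋄ idm H) ∘ lunit_inv H.

Definition rho_r : H ~> H ⋄ H :=
  (mul H ⋄ idm H) ∘ assoc_inv H H H ∘ (idm H ⋄ sigma) ∘ runit_inv H.

Definition axiom_r3 := antipode H ∘ v = v ∘ antipode H.
Definition axiom_r4 := epsilon H ∘ v = epsilon H.
Definition axiom_r5 := mul H ∘ (v ⋄ idm H) = v ∘ mul H.
Definition axiom_r6 :=
  sigma = (vinv ⋄ (vinv ∘ antipode H)) ∘ Delta H ∘ v ∘ eta H.
Definition axiom_r7 :=
  (Delta H ⋄ idm H) ∘ sigma =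
  (idm (H ⋄ H) ⋄ mul H) ∘ insert_mid H H sigma ∘ sigma.
Definition axiom_r8 :=
  Delta H ∘ vinv = (vinv ⋄ vinv) ∘ mu ∘ braid_inv H H ∘ Delta H.
Definition axiom_r9 :=
  (mul H ⋄ mul H)
    ∘ mid3 (antipode H) (mu ∘ braid_inv H H ∘ mu) (antipode H)
    ∘ (rho_l ⋄ rho_r) =
  braid H H.

End RibbonAxioms.

(* Main.v *)
From mathcomp Require Import all_boot all_fingroup boolp.
Require Import Defs.

Set Implicit Arguments.
Unset Strict Implicit.
Unset Printing Implicit Defensive.

Import GroupScope.

(** All three counterexamples carry the trivial twist: [v] is the identity and
    the copairing is [sigma = eta ⋄ eta].  Then (r3)-(r7) only say that [eta]
    is compatible with the other structure maps, [mu] is the identity, (r8)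
    becomes cocommutativity, [Delta = braid_inv ∘ Delta], and (r9) becomes
    [braid_inv = braid].

    For (a), take types and functions with the cartesian product.  The flip is
    an involution and diagonals are cocommutative, so a group becomes a Hopf
    algebra on which the trivial twist satisfies every ribbon axiom.  The unit
    object is terminal, hence the only candidate [l] is the constant map, and
    (i1) would then make the identity map of the group constant.  The group of
    two elements is enough ([bool_integral_independence]).

    For (b), a non-symmetric braiding is needed.  Fix a group [G].  A crossed
    [G]-set is a right [G]-set with an equivariant degree map to [G], where [G]
    acts on itself by conjugation; such sets are braided by letting the degree
    of one factor act on the other.  As morphisms take the equivariant
    relations that preserve the degree.  Relations, unlike functions, have room
    for integrals: they behave like matrices over the Booleans.

    The Hopf algebra is the set of arrows [s -> s ^ h] of the conjugation
    action, i.e. the pairs [(s, h)], with degree [[~ s, h] = s^-1 * s ^ h].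
    Multiplication composes arrows, comultiplication factors the source [s] in
    all possible ways, the integral is the set of loops at [1], and the
    cointegral is supported on the identity arrows.  This is modelled on the
    Drinfeld double of [G], seen as a braided Hopf algebra in its own category
    of modules.  It is unimodular for every [G] ([arrow_unimodular]).  On
    identity arrows cocommutativity says that [G] is commutative
    ([arrow_not_r8]), and [braid_inv = braid] makes every commutator central
    ([arrow_not_r9]).  Both fail for the symmetric group on three letters. *)

(** * Independence of the integral axioms: sets and functions *)

Definition fun_category : category.
Proof.
by refine (@Category Type (fun A B => A -> B) (fun A x => x)
  (fun A B C g f x => g (f x)) _ _ _).
Defined.

Definition fun_monoidal : monoidal.
Proof.
refine (@Monoidal fun_category (fun A B => (A * B)%type)
  (fun A B A' B' f g p => (f p.1, g p.2)) unit
  (fun A B C p => (p.1.1, (p.1.2, p.2))) (fun A B C p => ((p.1, p.2.1), p.2.2))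
  (fun A p => p.2) (fun A x => (tt, x)) (fun A p => p.1) (fun A x => (x, tt))
  _ _ _ _ _ _ _ _ _ _ _ _ _) => //= *; apply: funext => -[] //=.
- by case.
- by move=> ? [].
- by case.
- by move=> ? [].
Defined.

Definition fun_braided : braided.
Proof.
by refine (@Braided fun_monoidal (fun A B p => (p.2, p.1)) (fun A B p => (p.2, p.1))
  _ _ _ _ _) => //= *; apply: funext => -[] //=.
Defined.

Definition bool_hopf : hopf_algebra fun_braided.
Proof.
by refine (@HopfAlgebra fun_braided bool (fun x => (x, x)) (fun=> tt)
  (fun p => p.1 (+) p.2) (fun=> false) id id _ _ _ _ _ _ _ _ _ _ _ _ _ _) => //=;
  apply: funext; (repeat case) => //= *.
Defined.

Lemma bool_integral_independence :
  exists (C : braided) (H : hopf_algebra C)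
          (v vinv : H ~> H) (sigma : unit_ob ~> H ⋄ H),
     (mutually_inverse v vinv
      /\ axiom_r3 v /\ axiom_r4 v /\ axiom_r5 v /\ axiom_r6 v vinv sigma
      /\ axiom_r7 sigma /\ axiom_r8 vinv sigma /\ axiom_r9 sigma)
     /\ ~ (exists (L : unit_ob ~> H) (l : H ~> unit_ob),
             axiom_i1 l /\ axiom_i2 L /\ axiom_i3 L l /\ axiom_i4 L).
Proof.
exists fun_braided, bool_hopf, idfun, idfun, (fun=> (false, false)).
split; last first.
  (* [l] is constant, so (i1) at [true] reads [true = false]. *)
  case=> L [l [i1 _]].
  by move/(congr1 (fun f => f true)): i1.
by do !split; apply: funext; (repeat case).
Qed.

(** * The category of crossed sets and equivariant relations *)

Section CrossedSets.

Variable G : groupType.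

(** The right-handed version of the crossed sets of Whitehead, or of the
    Yetter-Drinfeld modules over a group. *)
Record xset := XSet {
  pt :> Type;
  act : pt -> G -> pt;
  deg : pt -> G;
  act1 : forall x, act x 1 = x;
  actM : forall x g h, act x (g * h) = act (act x g) h;
  deg_act : forall x g, deg (act x g) = deg x ^ g
}.

Record xrel (X Y : xset) := XRel {
  related :> X -> Y -> Prop;
  rel_act : forall x y g, related x y -> related (act x g) (act y g);
  rel_deg : forall x y, related x y -> deg x = deg y
}.

Lemma xrelP (X Y : xset) (R S : xrel X Y) :
  (forall x y, R x y <-> S x y) -> R = S.
Proof.
case: R S => [R aR dR] [S aS dS] /= e.
have {}e : R = S by apply: funext => x; apply: funext => y; apply: propext.
by subst S; congr XRel; apply: Prop_irrelevance.
Qed.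

(** Every structural isomorphism of the category is the graph of a map. *)
Definition xgraph (X Y : xset) (f : X -> Y)
  (fJ : forall x g, f (act x g) = act (f x) g)
  (fd : forall x, deg (f x) = deg x) : xrel X Y.
Proof.
refine (@XRel X Y (fun x y => f x = y) _ _).
- by move=> x _ g <-.
- by move=> x _ <-.
Defined.

Definition xid (X : xset) : xrel X X.
Proof. by apply: (@xgraph X X id). Defined.

Definition xcomp (X Y Z : xset) (S : xrel Y Z) (R : xrel X Y) : xrel X Z.
Proof.
refine (@XRel X Z (fun x z => exists2 y, R x y & S y z) _ _).
- by move=> x z g [y Rxy Syz]; exists (act y g); apply: rel_act.
- by move=> x z [y /rel_deg-> /rel_deg].
Defined.

Definition xcategory : category.
Proof.
refine (@Category xset xrel xid xcomp _ _ _) => *; apply: xrelP => x z /=; split.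
- by case=> y ? <-.
- by exists z.
- by case=> y <-.
- by exists x.
- by case=> y [t ? ?] ?; exists t => //; exists y.
- by case=> t ? [y ? ?]; exists y => //; exists t.
Defined.

Definition xprod (X Y : xset) : xset.
Proof.
refine (@XSet (X * Y) (fun p g => (act p.1 g, act p.2 g))
  (fun p => deg p.1 * deg p.2) _ _ _).
- by case=> x y; rewrite /= !act1.
- by case=> x y g h; rewrite /= !actM.
- by case=> x y g; rewrite /= !deg_act conjMg.
Defined.

Definition xunit : xset.
Proof.
by refine (@XSet unit (fun x _ => x) (fun=> 1) _ _ _) => // *; rewrite conj1g.
Defined.

Definition xtens (X Y X' Y' : xset) (R : xrel X X') (S : xrel Y Y') :
  xrel (xprod X Y) (xprod X' Y').
Proof.
refine (@XRel (xprod X Y) (xprod X' Y')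
  (fun p q => R p.1 q.1 /\ S p.2 q.2) _ _).
- by move=> p q g [? ?]; split; apply: rel_act.
- by move=> p q [/rel_deg /= -> /rel_deg->].
Defined.

Definition xassoc (X Y Z : xset) :
  xrel (xprod (xprod X Y) Z) (xprod X (xprod Y Z)).
Proof.
by refine (@xgraph (xprod (xprod X Y) Z) (xprod X (xprod Y Z))
  (fun p => (p.1.1, (p.1.2, p.2))) _ _) => //= *; rewrite mulgA.
Defined.

Definition xassoc_inv (X Y Z : xset) :
  xrel (xprod X (xprod Y Z)) (xprod (xprod X Y) Z).
Proof.
by refine (@xgraph (xprod X (xprod Y Z)) (xprod (xprod X Y) Z)
  (fun p => ((p.1, p.2.1), p.2.2)) _ _) => //= *; rewrite mulgA.
Defined.

Definition xlunit (X : xset) : xrel (xprod xunit X) X.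
Proof.
by refine (@xgraph (xprod xunit X) X snd _ _) => //= *; rewrite mul1g.
Defined.

Definition xlunit_inv (X : xset) : xrel X (xprod xunit X).
Proof.
by refine (@xgraph X (xprod xunit X) (fun x => (tt, x)) _ _) => //= *; rewrite mul1g.
Defined.

Definition xrunit (X : xset) : xrel (xprod X xunit) X.
Proof.
by refine (@xgraph (xprod X xunit) X fst _ _) => //= *; rewrite mulg1.
Defined.

Definition xrunit_inv (X : xset) : xrel X (xprod X xunit).
Proof.
by refine (@xgraph X (xprod X xunit) (fun x => (x, tt)) _ _) => //= *; rewrite mulg1.
Defined.

(* Two-sided inclusion of relations: [rel_split] eliminates the intermediate
   points of compositions, pairs first, and [rel_wit] guesses them again,
   componentwise so that each graph determines its own part of the witness. *)
Ltac rel_split := repeat match goal with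
  | H : ex2 _ _ |- _ => destruct H
  | H : _ /\ _ |- _ => destruct H
  | H : and3 _ _ _ |- _ => destruct H
  | p : prod _ _ |- _ => destruct p
  | p : pt (xprod _ _) |- _ => destruct p
  | p : pt xunit |- _ => destruct p
  | u : unit |- _ => destruct u
  | H : (_, _) = (_, _) |- _ => case: H => *
  | _ => progress simpl in *
  | _ => progress subst
  end.

Ltac rel_wit := repeat match goal with
  | |- exists2 _ : prod (prod _ _) (prod _ _), _ & _ =>  eexists ((_, _), (_, _))
  | |- exists2 _ : prod _ (prod _ _), _ & _ =>  eexists (_, (_, _))
  | |- exists2 _ : prod (prod _ _) _, _ & _ =>  eexists ((_, _), _)
  | |- exists2 _ : prod _ _, _ & _ =>  eexists (_, _)
  | |- exists2 _, _ & _ => eexists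
  | |- _ /\ _ => split
  | |- _ => progress simpl
  | |- _ => by eauto
  end.

Ltac rel_auto :=
  intros; apply: xrelP => ? ? /=; split; intros; rel_split; rel_wit.

Definition xmonoidal : monoidal.
Proof.
refine (@Monoidal xcategory xprod xtens xunit
  xassoc xassoc_inv xlunit xlunit_inv xrunit xrunit_inv
  _ _ _ _ _ _ _ _ _ _ _ _ _).
all: rel_auto.
Defined.

(** The inverse makes the degree come out right:
    [deg y ^ (deg x)^-1 * deg x = deg x * deg y]. *)
Definition xbraid (X Y : xset) : xrel (xprod X Y) (xprod Y X).
Proof.
refine (@xgraph (xprod X Y) (xprod Y X)
  (fun p => (act p.2 (deg p.1)^-1, p.1)) _ _) => [p g|p] /=.
- by rewrite -!actM deg_act -conjVg -conjgC.
- by rewrite deg_act -conjgCV.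
Defined.

Definition xbraid_inv (X Y : xset) : xrel (xprod Y X) (xprod X Y).
Proof.
refine (@xgraph (xprod Y X) (xprod X Y)
  (fun p => (p.2, act p.1 (deg p.2))) _ _) => [p g|p] /=.
- by rewrite -!actM deg_act -conjgC.
- by rewrite deg_act -conjgC.
Defined.

Definition xbraided : braided.
Proof.
refine (@Braided xmonoidal xbraid xbraid_inv _ _ _ _ _).
- move=> X Y X' Y' R S; apply: xrelP => -[x y] [y' x'] /=; split.
  + case=> -[a b] /= [Rxa Syb] [<- <-]; rewrite -(rel_deg Rxa).
    by eexists; split=> //=; apply: rel_act.
  + case=> _ <- /= [Syy Rxx].
    exists (x', act y' (deg x')) => /=; last by rewrite -actM mulgV act1.
    split=> //; rewrite -(rel_deg Rxx).
    by move: (rel_act (deg x) Syy); rewrite -actM mulVg act1.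
- move=> X Y; apply: xrelP => -[x y] p; split=> /=.
  + by case=> _ <- /= <-; rewrite -actM mulVg act1.
  + by move<-; eexists => //=; rewrite -actM mulVg act1.
- move=> X Y; apply: xrelP => -[x y] p; split=> /=.
  + by case=> _ <- /= <-; rewrite -actM mulgV act1.
  + by move<-; eexists => //=; rewrite -actM mulgV act1.
- rel_auto.
- rel_auto.
  + by rewrite invMg actM.
  + by rewrite invMg actM.
Defined.

(** The compositions of associators in [mid3] and [insert_mid] only rebracket
    points, so both operations have a description without associators; the
    computations below rely on it. *)
Definition xmid (A1 A2 A3 A4 B1 B2 B3 B4 : ob xbraided)
    (f : A1 ~> B1) (g : A2 ⋄ A3 ~> B2 ⋄ B3) (h : A4 ~> B4) :
  (A1 ⋄ A2) ⋄ (A3 ⋄ A4) ~> (B1 ⋄ B2) ⋄ (B3 ⋄ B4).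
Proof.
refine (@XRel (xprod (xprod A1 A2) (xprod A3 A4))
  (xprod (xprod B1 B2) (xprod B3 B4)) (fun p q => [/\ related f p.1.1 q.1.1,
  related g (p.1.2, p.2.1) (q.1.2, q.2.1) & related h p.2.2 q.2.2]) _ _).
- move=> p q x [fx gx hx].
  by split; [apply: rel_act fx | apply: rel_act gx | apply: rel_act hx].
- move=> p q [/rel_deg fx /rel_deg /= gx /rel_deg hx] /=.
  by rewrite fx hx -!mulgA (mulgA (deg p.1.2)) gx !mulgA.
Defined.

Lemma xmid3E (A1 A2 A3 A4 B1 B2 B3 B4 : ob xbraided)
    (f : A1 ~> B1) (g : A2 ⋄ A3 ~> B2 ⋄ B3) (h : A4 ~> B4) :
  mid3 f g h = xmid f g h.
Proof.
apply: xrelP => -[[p1 p2] [p3 p4]] [[q1 q2] [q3 q4]] /=; split=> [H|[? ? ?]].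
  by rel_split.
by rel_wit.
Qed.

Definition xinsert (A D X Y : ob xbraided) (s : unit_ob ~> X ⋄ Y) :
  A ⋄ D ~> (A ⋄ X) ⋄ (Y ⋄ D).
Proof.
refine (@XRel (xprod A D) (xprod (xprod A X) (xprod Y D))
  (fun p q => [/\ p.1 = q.1.1, related s tt (q.1.2, q.2.1) & p.2 = q.2.2]) _ _).
- by move=> p q x [/= -> sx ->]; split=> //; apply: rel_act sx.
- move=> [a d] [[a' x] [y d']] /= [-> /rel_deg /= sx ->].
  by rewrite -!mulgA (mulgA (deg x)) -sx mul1g.
Defined.

Lemma xinsertE (A D X Y : ob xbraided) (s : unit_ob ~> X ⋄ Y) :
  insert_mid A D s = xinsert A D s.
Proof.
apply: xrelP => -[p1 p2] [[q1 q2] [q3 q4]] /=; split=> [H|[<- ? <-]].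
  by rel_split.
by rel_wit.
Qed.

(** * The Hopf algebra of arrows of the conjugation action *)

(** The pair [(s, h)] is the arrow from [s] to [s ^ h]; its degree is the inverse
    of the source times the target, which is multiplicative under composition
    of arrows. *)
Definition arrow_xset : xset.
Proof.
refine (@XSet (G * G) (fun x g => (x.1 ^ g, x.2 ^ g)) (fun x => [~ x.1, x.2]) _ _ _).
- by case=> s h; rewrite /= !conjg1.
- by case=> s h x y; rewrite /= !conjgM.
- by case=> s h x; rewrite /= conjRg.
Defined.

(* The type is what lets the notations for morphisms find the braided
   category. *)
Definition arrow_ob : ob xbraided := arrow_xset.

(* Decides identities between words in a group. *)
Ltac grp := rewrite /= ?commgEl /conjg ?gnorm //.

(** The source is factored as [s = b * a], with [a] in the first tensor factor.
    The label [h ^ b] there, in place of [h], is what preserves the degree: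
    [[~ b * a, h] = [~ a, h ^ b] * [~ b, h]]. *)
Definition arrow_comul : arrow_ob ~> arrow_ob ⋄ arrow_ob.
Proof.
refine (@XRel arrow_xset (xprod arrow_xset arrow_xset)
  (fun x p => [/\ x.1 = p.2.1 * p.1.1, p.2.2 = x.2 & p.1.2 = x.2 ^ p.2.1]) _ _).
- by move=> [s h] [[a k] [b l]] g /= [-> -> ->]; split=> //; grp.
- by move=> [s h] [[a k] [b l]] /= [-> -> ->]; grp.
Defined.

Definition arrow_counit : arrow_ob ~> unit_ob.
Proof.
refine (@XRel arrow_xset xunit (fun x _ => x.1 = 1) _ _).
- by move=> [s h] _ g /= ->; grp.
- by move=> [s h] _ /= ->; grp.
Defined.

Definition arrow_mul : arrow_ob ⋄ arrow_ob ~> arrow_ob.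
Proof.
refine (@XRel (xprod arrow_xset arrow_xset) arrow_xset
  (fun p x => [/\ p.2.1 = p.1.1 ^ p.1.2, x.1 = p.1.1 & x.2 = p.1.2 * p.2.2]) _ _).
- by move=> [[a k] [b l]] [s h] g /= [-> -> ->]; split=> //; grp.
- by move=> [[a k] [b l]] [s h] /= [-> -> ->]; grp.
Defined.

Definition arrow_unit : unit_ob ~> arrow_ob.
Proof.
refine (@XRel xunit arrow_xset (fun _ x => x.2 = 1) _ _).
- by move=> _ [s h] g /= ->; grp.
- by move=> _ [s h] /= ->; grp.
Defined.

(** Up to conjugation by the source this is the inverse arrow, based at inverse
    points; the conjugation compensates the label [h ^ b] in the
    comultiplication. *)
Definition arrow_antipode : arrow_ob ~> arrow_ob.
Proof.
refine (@xgraph arrow_xset arrow_xset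
  (fun x => (x.1^-1 ^ (x.2 * x.1), x.2^-1 ^ x.1)) _ _).
- by move=> [s h] g /=; congr pair; grp.
- by move=> [s h] /=; grp.
Defined.

Definition arrow_antipode_inv : arrow_ob ~> arrow_ob.
Proof.
refine (@xgraph arrow_xset arrow_xset
  (fun x => (x.1^-1 ^ x.2, x.2^-1 ^ (x.1 ^ x.2))) _ _).
- by move=> [s h] g /=; congr pair; grp.
- by move=> [s h] /=; grp.
Defined.


Lemma arrow_coassoc :
  assoc arrow_ob arrow_ob arrow_ob ∘ (arrow_comul ⋄ idm _) ∘ arrow_comul =
  (idm _ ⋄ arrow_comul) ∘ arrow_comul.
Proof.
apply: xrelP => -[s h] [[x1 h1] [[x2 h2] [x3 h3]]]; split.
- case=> -[[a k] [b l]] [/= -> -> ->].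
  case=> -[[[y1 l1] [y2 l2]] [y3 l3]] [/= [-> -> ->] [<- <-]] [<- <- <- <- <- <-].
  by exists ((y1, h ^ (b * y2)), (b * y2, h)); do !split => //=; grp.
- case=> -[[a k] [b l]] [/= -> -> ->] [/= [<- <-] [-> -> ->]].
  exists ((x2 * a, h ^ x3), (x3, h)); first by split=> //=; grp.
  by exists ((a, h ^ (x3 * x2), (x2, h ^ x3)), (x3, h)); do !split => //=; grp.
Qed.

Lemma arrow_counitl :
  lunit arrow_ob ∘ (arrow_counit ⋄ idm _) ∘ arrow_comul = idm _.
Proof.
apply: xrelP => -[s h] [t k]; split.
- case=> -[[a l] [b m]] [/= -> -> _] [[[] c]] [/= -> <-] <-.
  by grp.
- case=> <- <-.
  exists ((1, h ^ s), (s, h)); first by split=> //=; grp.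
  by exists (tt, (s, h)).
Qed.

Lemma arrow_counitr :
  runit arrow_ob ∘ (idm _ ⋄ arrow_counit) ∘ arrow_comul = idm _.
Proof.
apply: xrelP => -[s h] [t k]; split.
- case=> -[[a l] [b m]] [/= -> _ ->] [[c []]] [/= <- ->] <-.
  by grp.
- case=> <- <-.
  exists ((s, h), (1, h)); first by split=> //=; grp.
  by exists ((s, h), tt).
Qed.

Lemma arrow_assoc :
  arrow_mul ∘ (arrow_mul ⋄ idm _) =
  arrow_mul ∘ (idm _ ⋄ arrow_mul) ∘ assoc arrow_ob arrow_ob arrow_ob.
Proof.
apply: xrelP => -[[[s1 h1] [s2 h2]] [s3 h3]] [t k]; split.
- case=> -[[a l] [b m]] [/= [-> -> ->] [<- <-]] [/= -> -> ->].
  exists ((s1, h1), ((s1 ^ h1, h2), (s1 ^ (h1 * h2), h3))) => //.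
  by exists ((s1, h1), (s1 ^ h1, h2 * h3)); do !split => //=; grp.
- case=> _ <- [[[a l] [b m]]] [/= [<- <-] [-> -> ->]] [/= -> -> ->].
  by exists ((s1, h1 * h2), (s1 ^ (h1 * h2), h3)); do !split => //=; grp.
Qed.

Lemma arrow_unitr :
  arrow_mul ∘ (idm _ ⋄ arrow_unit) ∘ runit_inv arrow_ob = idm _.
Proof.
apply: xrelP => -[s h] [t k]; split.
- case=> _ <- [[[a l] [b m]]] [/= [<- <-] ->] [/= _ -> ->].
  by rewrite mulg1.
- case=> <- <-; exists ((s, h), tt) => //.
  by exists ((s, h), (s ^ h, 1)); do !split => //=; grp.
Qed.

Lemma arrow_unitl :
  arrow_mul ∘ (arrow_unit ⋄ idm _) ∘ lunit_inv arrow_ob = idm _.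
Proof.
apply: xrelP => -[s h] [t k]; split.
- case=> _ <- [[[a l] [b m]]] [/= -> [<- <-]] [/= -> -> ->].
  by rewrite mul1g conjg1.
- case=> <- <-; exists (tt, (s, h)) => //.
  by exists ((s, 1), (s, h)); do !split => //=; grp.
Qed.

(** With [D = [~ b, h]] the degree acting in the braiding, the target [b ^ h] of
    the second factor of the first arrow satisfies [(b ^ h) ^ D^-1 = b].  So the
    label twisted by [b ^ h] becomes one twisted by [b], which is what the
    coproduct of the composite arrow requires. *)
Lemma arrow_bialgebra :
  (arrow_mul ⋄ arrow_mul) ∘ mid3 (idm _) (braid arrow_ob arrow_ob) (idm _)
    ∘ (arrow_comul ⋄ arrow_comul) = arrow_comul ∘ arrow_mul.
Proof.
rewrite xmid3E; apply: xrelP => -[[s h] [s' h']] [[t k] [t' k']]; split.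
- case=> -[[[a l] [b m]] [[a' l'] [b' m']]] [/= [-> -> ->] [-> -> ->]].
  case=> -[[[c1 n1] [c2 n2]] [[c3 n3] [c4 n4]]].
  case=> -[<- <-] [<- <- <- <-] [<- <-] [/= [e -> ->] [-> -> ->]].
  exists (b * a, h * h'); last by split=> //=; grp.
  by split=> //=; move/(canRL (conjgKV _)): e => ->; grp.
- case=> -[a l] [/= -> -> ->] [/= -> -> ->].
  exists (((t, h ^ t'), (t', h)), ((t ^ h, h' ^ (t' ^ h)), (t' ^ h, h'))).
    by do !split => //=; grp.
  exists (((t, h ^ t'), (t ^ (h ^ t'), h' ^ t')), ((t', h), (t' ^ h, h'))).
    do !split => //=; congr ((_, _), (_, _)); grp.
  by do !split => //=; grp.
Qed.

Lemma arrow_counit_mul :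
  arrow_counit ∘ arrow_mul = lunit unit_ob ∘ (arrow_counit ⋄ arrow_counit).
Proof.
apply: xrelP => -[[s h] [s' h']] []; split.
- case=> -[a l] [/= -> -> _] ->.
  by exists (tt, tt) => //; split=> //=; rewrite conj1g.
- case=> _ [/= -> ->] _; exists (1, h * h') => //.
  by split=> //=; rewrite conj1g.
Qed.

Lemma arrow_comul_unit :
  arrow_comul ∘ arrow_unit = (arrow_unit ⋄ arrow_unit) ∘ lunit_inv unit_ob.
Proof.
apply: xrelP => -[] [[a k] [b l]]; split.
- case=> -[s h] /= -> [/= _ -> ->].
  by exists (tt, tt) => //; split=> //=; rewrite conj1g.
- case=> _ _ [/= -> ->]; exists (b * a, 1) => //.
  by split=> //=; rewrite conj1g.
Qed.

Lemma arrow_counit_unit : arrow_counit ∘ arrow_unit = idm unit_ob.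
Proof.
apply: xrelP => -[] []; split=> // _.
by exists (1, 1).
Qed.

Lemma arrow_antipodel :
  arrow_mul ∘ (arrow_antipode ⋄ idm _) ∘ arrow_comul = arrow_unit ∘ arrow_counit.
Proof.
apply: xrelP => -[s h] [t k]; split.
- case=> -[[a l] [b m]] [/= -> -> ->].
  case=> -[[c n] [d q]] [/= [<- <-] [<- <-]] [/= e _ ->].
  (* Composability forces the two sources to be inverse, i.e. [s = 1]. *)
  have {}e: b = a^-1 by move: e; grp.
  by exists tt; rewrite /= ?e; grp.
- case=> _ /= -> ->.
  exists ((t^-1 ^ h^-1, h ^ (t ^ h^-1)), (t ^ h^-1, h)) => /=.
    by split=> //=; grp.
  by exists ((t, h^-1), (t ^ h^-1, h)); do !split; rewrite //=; try congr pair; grp.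
Qed.

Lemma arrow_antipoder :
  arrow_mul ∘ (idm _ ⋄ arrow_antipode) ∘ arrow_comul = arrow_unit ∘ arrow_counit.
Proof.
apply: xrelP => -[s h] [t k]; split.
- case=> -[[a l] [b m]] [/= -> -> ->].
  case=> -[[c n] [d q]] [/= [<- <-] [<- <-]] [/= e _ ->].
  have {}e: a = b^-1 by apply: (conjg_inj (h ^ b)); rewrite -e; grp.
  by exists tt; rewrite /= ?e; grp.
- case=> _ /= -> ->.
  exists ((t, h ^ t^-1), (t^-1, h)) => /=.
    by split=> //=; grp.
  exists ((t, h ^ t^-1), (t ^ (h ^ t^-1), h^-1 ^ t^-1)); do !split;
    rewrite //=; try congr pair; grp.
Qed.

Lemma arrow_antipodeK : arrow_antipode ∘ arrow_antipode_inv = idm _.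
Proof.
apply: xrelP => -[s h] [t k]; split.
- case=> _ <- <- /=; congr pair; grp.
- case=> <- <-; eexists; first by [].
  by rewrite /=; congr pair; grp.
Qed.

Lemma arrow_antipodeVK : arrow_antipode_inv ∘ arrow_antipode = idm _.
Proof.
apply: xrelP => -[s h] [t k]; split.
- case=> _ <- <- /=; congr pair; grp.
- case=> <- <-; eexists; first by [].
  by rewrite /=; congr pair; grp.
Qed.

Definition arrow_hopf : hopf_algebra xbraided :=
  @HopfAlgebra xbraided arrow_ob arrow_comul arrow_counit arrow_mul arrow_unit
    arrow_antipode arrow_antipode_inv
    arrow_coassoc arrow_counitl arrow_counitr arrow_assoc arrow_unitr arrow_unitl
    arrow_bialgebra arrow_counit_mul arrow_comul_unit arrow_counit_unit
    arrow_antipodel arrow_antipoder arrow_antipodeK arrow_antipodeVK.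

(** * Integrals *)

Definition arrow_integral : unit_ob ~> arrow_ob.
Proof.
refine (@XRel xunit arrow_xset (fun _ x => x.1 = 1) _ _).
- by move=> _ [s h] g /= ->; grp.
- by move=> _ [s h] /= ->; grp.
Defined.

Definition arrow_cointegral : arrow_ob ~> unit_ob.
Proof.
refine (@XRel arrow_xset xunit (fun x _ => x.2 = 1) _ _).
- by move=> [s h] _ g /= ->; grp.
- by move=> [s h] _ /= ->; grp.
Defined.

Lemma arrow_i1 : @axiom_i1 _ arrow_hopf arrow_cointegral.
Proof.
apply: xrelP => -[s h] [t k]; split.
- case=> -[[a l] [b m]] [/= _ -> ->] [[c []]] [/= <- ->] [_ <-].
  by exists tt => //; rewrite conj1g.
- case=> _ /= -> ->; exists ((t, 1), (s * t^-1, 1)).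
    by split=> //=; grp.
  by exists ((t, 1), tt).
Qed.

Lemma arrow_i2 : @axiom_i2 _ arrow_hopf arrow_integral.
Proof.
apply: xrelP => -[s h] [t k]; split.
- case=> _ <- [[[a l] [b m]]] [/= -> [<- <-]] [/= -> -> _].
  by exists tt => //; rewrite conj1g.
- case=> _ /= -> ->; exists (tt, (1, h)) => //.
  by exists ((1, k * h^-1), (1, h)); do !split => //=; grp.
Qed.

Lemma arrow_i3 : @axiom_i3 _ arrow_hopf arrow_integral arrow_cointegral.
Proof. by apply: xrelP => -[] []; split=> // _; exists (1, 1). Qed.

Lemma arrow_i4 : @axiom_i4 _ arrow_hopf arrow_integral.
Proof.
apply: xrelP => -[] [t k]; split.
- by case=> -[s h] /= -> [<- _]; grp.
- by move=> /= ->; exists (1, k^-1) => //=; congr pair; grp.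
Qed.

Lemma arrow_i5 : @axiom_i5 _ arrow_hopf arrow_cointegral.
Proof.
apply: xrelP => -[s h] []; split.
- by case=> -[t k] /= [_ <-] /eqP; rewrite conjg_eq1 eq_invg1 => /eqP.
- by move=> /= ->; eexists; first by []; rewrite /=; grp.
Qed.

Definition arrow_unimodular : unimodular_hopf_algebra xbraided :=
  UnimodularHopfAlgebra arrow_i1 arrow_i2 arrow_i3 arrow_i4 arrow_i5.

(** * The trivial twist *)

Definition unit_copairing : unit_ob ~> arrow_ob ⋄ arrow_ob :=
  (arrow_unit ⋄ arrow_unit) ∘ lunit_inv unit_ob.

Lemma arrow_muE : @mu _ arrow_hopf unit_copairing = idm _.
Proof.
rewrite /mu xinsertE.
apply: xrelP => -[[s h] [s' h']] [[t k] [t' k']]; split.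
- case=> -[[[a1 l1] [a2 l2]] [[a3 l3] [a4 l4]]].
  case=> /= -[<- <-] [_ _ [-> ->]] [<- <-] [[_ -> ->] [-> -> ->]].
  by rewrite conjg1 mulg1 mul1g.
- case=> -[<- <-] [<- <-].
  exists (((s, h), (s ^ h, 1)), ((s', 1), (s', h'))).
    by split=> //; exists (tt, tt).
  by do !split=> //=; grp.
Qed.

Lemma arrow_r6 : @axiom_r6 _ arrow_hopf (idm _) (idm _) unit_copairing.
Proof.
apply: xrelP => -[] [[a k] [b l]]; split.
- case=> _ _ [/= -> ->].
  exists (b^-1 * a, 1) => //; exists (b^-1 * a, 1) => //.
  exists ((a, 1), (b^-1, 1)); first by split=> //=; grp.
  split=> //=; exists (b, 1) => //.
  congr pair; grp.
- case=> -[s h] /= -> [_ <-] [[[c n] [d m]]] [/= _ -> ->].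
  case=> -[_ <-] [_ <- [_ <-]].
  by exists (tt, tt) => //; split=> /=; grp.
Qed.

Lemma arrow_r7 : @axiom_r7 _ arrow_hopf unit_copairing.
Proof.
rewrite /axiom_r7 xinsertE.
apply: xrelP => -[] [[[a1 l1] [a2 l2]] [a3 l3]]; split.
- case=> -[[s h] [t k]] [_ _ [/= -> ->]] [/= [_ -> ->] [<- <-]].
  exists ((a1, 1), (t, 1)); first by exists (tt, tt).
  exists (((a1, 1 ^ a2), (a2, 1)), ((t, 1), (t, 1))).
    by split=> //=; [rewrite conj1g | exists (tt, tt)].
  by do !split=> //=; grp.
- case=> -[[s h] [t k]] [_ _ [/= -> ->]].
  case=> -[[[c1 n1] [c2 n2]] [[c3 n3] [c4 n4]]].
  case=> /= -[<- <-] [_ _ [-> ->]] [<- <-].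
  case=> -[[<- <-] [<- <-]] [_ -> ->].
  exists ((c2 * s, 1), (c3, 1)); first by exists (tt, tt).
  by do !split=> //=; grp.
Qed.

Lemma arrow_trivial_twist (H := arrow_unimodular) (i := idm arrow_ob : H ~> H) :
  mutually_inverse i i
  /\ axiom_r3 i /\ axiom_r4 i /\ axiom_r5 i /\ @axiom_r6 _ H i i unit_copairing
  /\ @axiom_r7 _ H unit_copairing.
Proof.
split; first by split; apply: comp_idl.
split; first by rewrite /axiom_r3 comp_idl comp_idr.
split; first exact: comp_idr.
split; first by rewrite /axiom_r5 tensm_id comp_idl comp_idr.
by split; [apply: arrow_r6 | apply: arrow_r7].
Qed.

(** The identity arrow at [a * b] splits into the identity arrows at [b] and
    [a], in this order.  Identity arrows have degree [1], so that [braid_inv]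
    just exchanges them, and (r8) would give the other order too. *)
Lemma arrow_not_r8 (a b : G) :
  a * b <> b * a -> ~ @axiom_r8 _ arrow_hopf (idm _) unit_copairing.
Proof.
move=> ab; rewrite /axiom_r8 arrow_muE tensm_id !comp_idl comp_idr => e.
have: related (Delta arrow_hopf) (a * b, 1) ((b, 1), (a, 1)).
  by split=> //=; grp.
rewrite e => -[[[c n] [d m]] [/= abE -> _]].
rewrite commg1 !conjg1 => -[db ca _]; case: ab.
by rewrite abE db ca.
Qed.

(** (r9) would give [braid = braid_inv], tested on the arrow [(a, b)], of degree
    [[~ a, b]], and the identity arrow at [c], of degree [1]: both braidings
    leave the arrow unchanged, [braid_inv] fixes [c] and [braid] conjugates it
    by [[~ a, b]^-1]. *)
Lemma arrow_not_r9 (a b c : G) :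
  c ^ [~ a, b] <> c -> ~ @axiom_r9 _ arrow_hopf unit_copairing.
Proof.
move=> abc; rewrite /axiom_r9 arrow_muE comp_idl comp_idr xmid3E => e.
have: related (braid arrow_ob arrow_ob) ((a, b), (c, 1)) ((c, 1), (a, b)).
  rewrite -e.
  (* Of all the pairs of identity arrows in the copairing, only those composable
     with the given arrows contribute, after inversion by the antipode. *)
  exists (((c^-1, 1), (a, b)), ((c, 1), ((a ^ b)^-1, 1))).
    split.
      exists (tt, (a, b)) => //.
      exists (((c^-1, 1), (a, 1)), (a, b)); first by split=> //; exists (tt, tt).
      exists ((c^-1, 1), ((a, 1), (a, b))) => //.
      by do !split=> //=; grp.
    exists ((c, 1), tt) => //.
    exists ((c, 1), ((c, 1), ((a ^ b)^-1, 1))); first by split=> //; exists (tt, tt).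
    exists (((c, 1), (c, 1)), ((a ^ b)^-1, 1)) => //.
    by do !split=> //=; grp.
  exists (((c, 1), (c, 1)), ((a, b), (a ^ b, 1))).
    do !split=> //=.
    + by congr pair; grp.
    + by congr (_, (_, _)); grp.
    + by congr pair; grp.
  by do !split=> //=; grp.
case=> /(canRL (conjgKV _)) ec _; case: abc.
by rewrite {2}ec.
Qed.

End CrossedSets.

(** * Independence of (r8) and (r9): the symmetric group on three letters *)

Lemma S3_commg (a := tperm ord0 (inord 1) : 'S_3) (b := tperm (inord 1) ord_max) :
  a ^ [~ a, b] <> a.
Proof.
have n01 : (ord0 : 'I_3) != inord 1 by rewrite -val_eqE /= inordK.
have n10 : (inord 1 : 'I_3) != ord0 by rewrite eq_sym.
have n21 : (ord_max : 'I_3) != inord 1 by rewrite -val_eqE /= inordK.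
have ab : a ^ b = tperm ord0 ord_max by rewrite tpermJ tpermL tpermD.
rewrite commgEl ab tpermV tpermJ !permM tpermL tpermR tpermL tpermD //.
by move/permP/(_ ord0)/eqP; rewrite tpermL tpermD // (negPf n01).
Qed.

Theorem proposition2p5 :
  (exists (C : braided) (H : hopf_algebra C)
          (v vinv : H ~> H) (sigma : unit_ob ~> H ⋄ H),
     (mutually_inverse v vinv
      /\ axiom_r3 v /\ axiom_r4 v /\ axiom_r5 v /\ axiom_r6 v vinv sigma
      /\ axiom_r7 sigma /\ axiom_r8 vinv sigma /\ axiom_r9 sigma)
     /\ ~ (exists (L : unit_ob ~> H) (l : H ~> unit_ob),
             axiom_i1 l /\ axiom_i2 L /\ axiom_i3 L l /\ axiom_i4 L))
  /\
  (exists (C : braided) (H : unimodular_hopf_algebra C)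
          (v vinv : H ~> H) (sigma : unit_ob ~> H ⋄ H),
     (mutually_inverse v vinv
      /\ axiom_r3 v /\ axiom_r4 v /\ axiom_r5 v /\ axiom_r6 v vinv sigma
      /\ axiom_r7 sigma)
     /\ ~ axiom_r8 vinv sigma)
  /\
  (exists (C : braided) (H : unimodular_hopf_algebra C)
          (v vinv : H ~> H) (sigma : unit_ob ~> H ⋄ H),
     (mutually_inverse v vinv
      /\ axiom_r3 v /\ axiom_r4 v /\ axiom_r5 v /\ axiom_r6 v vinv sigma
      /\ axiom_r7 sigma)
     /\ ~ axiom_r9 sigma).
Proof.

have c := S3_commg; set a := tperm _ _ in c; set b := tperm _ _ in c.
set d := [~ a, b] in c.
have ad : a * d <> d * a by move=> e; apply: c; rewrite /conjg e mulKg.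
split; first exact: bool_integral_independence.
have [twist_inv twist] := arrow_trivial_twist 'S_3.
split; exists (xbraided _), (arrow_unimodular _), (idm _), (idm _),
  (unit_copairing 'S_3); split=> //.
- exact: arrow_not_r8 ad.
- exact: arrow_not_r9 c.
Qed.
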